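(* Let $f:\mathcal{A}\rightarrow \mathcal{A}$ satisfy the congruence condition $$f(A+BP)\equiv f(A) \pmod P\quad\text{for every } A,B\in\mathcal{A} \text{ and every } P\in\mathcal{P}.$$ Assume there exist $U\in \mathcal{A}$ with $U'\neq 0$ (i.e. $U$ is not the $p$-th power of an element of $\overline{\mathbb{F}}[t]$) and positive integers $C_5$ and $C_6$ such that $\deg(f(U^n))\leq C_5n+C_6$ for every integer $n\geq 0$. Then $f$ is a polynomial map.
   Context: $\mathbb{F}$ is the finite field of order $q$ and characteristic $p$, $\overline{\mathbb{F}}$ is its algebraic closure, $\mathcal{A}=\mathbb{F}[t]$, and $\mathcal{K}=\mathbb{F}(t)$. $\deg$ is the usual degree on $\mathcal{A}$, with $\deg(0)=-\infty$. $U'$ denotes the formal derivative of $U$ with respect to $t$. $\mathcal{P}\subset\mathcal{A}$ is the set of irreducible polynomials. A map $f:\mathcal{A}\to\mathcal{A}$ is called a polynomial map if it is given by the values on $\mathcal{A}$ of an element of $\mathcal{K}[X]$, i.e. there is $F(X)\in\mathcal{K}[X]$ with $f(A)=F(A)$ for every $A\in\mathcal{A}$. *)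

(* Defs.v *)
From HB Require Import structures.
From mathcomp Require Import all_boot all_order all_algebra.

Set Implicit Arguments.
Unset Strict Implicit.
Unset Printing Implicit Defensive.

Import GRing.Theory.
Local Open Scope ring_scope.

Definition polynomial_map (F : fieldType) (f : {poly F} -> {poly F}) : Prop :=
  exists G : {poly {fraction {poly F}}},
    forall A : {poly F}, FracField.tofrac (f A) = G.[FracField.tofrac A].

Definition prime_congruence (F : fieldType) (f : {poly F} -> {poly F}) : Prop :=
  forall A B P : {poly F}, irreducible_poly P -> P %| f (A + B * P) - f A.

(* Since size is 1 + degree and size 0 = 0, this is deg A <= d with
   deg 0 = -oo. *)
Definition deg_le (F : fieldType) (A : {poly F}) (d : nat) : Prop :=
  (size A <= d.+1)%N.

(* Main.v *)
Require Import Defs.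
From HB Require Import structures.
From mathcomp Require Import all_boot all_order all_algebra.
From mathcomp Require Import finfield zify ring.

Set Implicit Arguments.
Unset Strict Implicit.
Unset Printing Implicit Defensive.

Import GRing.Theory.
Local Open Scope ring_scope.

(** The values of [f] at powers of [U] turn out to be those of an interpolation
    polynomial of fixed degree, because congruences with a fixed finite set of
    nodes already determine [f (U ^+ N)] once [N] is large.

    If every irreducible factor of [g] divides [Z], then [g] divides [g' * Z]:
    repeated factors of [g] reappear in [g'] ([dvdp_deriv_mul]).  Apply this to
    [g = A - U ^+ N], where [U * g' = U * A' - N * U' * A] modulo [g], and to
    [Z = d * f A - H.[A]], where [d] is a nonzero element and [H] a polynomial
    such that [d * f] and [H] agree at [U ^+ N].  The congruence condition makes
    each irreducible factor of [g] divide [Z], hence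
      [A - U ^+ N] divides [(U * A' - N * U' * A) * Z]
    ([dvdp_wronskian_defect]).  All that follows comes from this divisibility
    and from comparing degrees.

    Suppose that [deg (f (U ^+ n)) <= k * n + O(1)], let [p] be the
    characteristic and let [H] (of degree at most [k]) and [d] interpolate [f]
    at the [k + 1] nodes [U ^+ (c + p * i)].  For [A = U ^+ N] with [N] not
    congruent to [c] modulo [p], the divisibility becomes
      [U ^+ (N - c - p * i) - 1] divides [U' * Z]   for [i = 0, ..., k].
    These [k + 1] divisors are coprime up to factors independent of [N]
    ([prod_progression_dvdp]), so, if [Z] is nonzero, its degree is at least
    [(k + 1) * deg U * N - O(1)]; but it is at most [k * deg U * N + O(1)].
    Hence [Z = 0] for all large such [N] ([agree_on_large_powers]).  Starting
    from nodes with [c = 0] gives agreement at all large [N] prime to [p]; among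
    these are nodes with [c = 1], from which the same argument reaches the large
    multiples of [p].

    Finally fix any nonzero [A].  Letting [N] tend to infinity with constant
    residue modulo [p], the fixed polynomial [(U * A' - N * U' * A) * Z] has
    divisors [A - U ^+ N] of unbounded degree, so it vanishes.  The first
    factor cannot vanish for both residues [0] and [1], since the difference is
    [U' * A]; therefore [Z = 0].  The value at [0] follows from
    [f 0 = f P] modulo every irreducible [P] ([agree_everywhere]). *)

(** * Irreducible factors and congruences *)

Lemma irreducible_factor (F : finFieldType) (g : {poly F}) :
  (1 < size g)%N -> exists2 P, irreducible_poly P & P %| g.
Proof.
have [n] := ubnP (size g); elim: n g => // n IHn g lt_gn g_gt1.
case: (irreducibleP g) => [irr_g|]; first by exists g.
move/irreducibleP; rewrite /irreducibleb g_gt1 /= => /forallPn[q].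
rewrite negb_imply -ltnNge => /andP[q_dvd q_gt1].
have lt_qg : (size (q : {poly F}) < size g)%N.
  by rewrite (leq_ltn_trans (size_npoly q)) ?ltn_predL ?(ltnW g_gt1).
have [|//|P irrP P_dvd] := IHn (q : {poly F}); first by lia.
exists P => //; apply: dvdp_trans P_dvd _.
by rewrite dvdpE.
Qed.

(** If [P] divides [g] with multiplicity [e], then it divides [g'] with
    multiplicity at least [e - 1], and [Z] supplies the missing factor.  Peeling
    off one irreducible factor at a time avoids speaking of multiplicities. *)
Lemma dvdp_deriv_mul (F : finFieldType) (g Z : {poly F}) :
  (forall P, irreducible_poly P -> P %| g -> P %| Z) -> g %| g^`() * Z.
Proof.
have [n] := ubnP (size g); elim: n g => // n IHn g lt_gn irr_dvd.
have [g_le1|g_gt1] := leqP (size g) 1.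
  by rewrite [in X in _ %| X](size1_polyC g_le1) derivC mul0r dvdp0.
have [P irrP P_dvd] := irreducible_factor g_gt1.
have /dvdpP[h def_g] := P_dvd.
have P_gt1 : (1 < size P)%N by case: irrP.
have g_neq0 : g != 0 by rewrite -size_poly_gt0; lia.
have [h_neq0 P_neq0] : h != 0 /\ P != 0.
  by apply/andP; rewrite -negb_or -mulf_eq0 -def_g.
have h_dvd : h %| h^`() * Z.
  apply: IHn => [|Q irrQ Q_dvd].
    move: lt_gn P_gt1; rewrite def_g size_mul //.
    by move: (size h) (size P) => sh sP; lia.
  by apply: irr_dvd => //; rewrite def_g dvdp_mulr.
have P_dvdZ : P %| Z by apply: irr_dvd.
rewrite def_g derivM mulrDl dvdp_add //.
  by rewrite mulrAC dvdp_mul.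
by rewrite -mulrA dvdp_mul // dvdp_mull.
Qed.

Lemma dvdp_horner_sub (R : idomainType) (H : {poly {poly R}}) (A B : {poly R}) :
  A - B %| H.[A] - H.[B].
Proof.
elim/poly_ind: H => [|H c IH]; first by rewrite !horner0 subrr dvdp0.
rewrite !hornerMXaddC.
have -> : H.[A] * A + c - (H.[B] * B + c) =
          (H.[A] - H.[B]) * A + H.[B] * (A - B) by ring.
by apply: dvdp_add; [apply: dvdp_mulr | apply: dvdp_mull].
Qed.

Lemma congruence_dvdp (F : fieldType) (f : {poly F} -> {poly F})
    (A B P : {poly F}) :
  prime_congruence f -> irreducible_poly P -> P %| A - B -> P %| f A - f B.
Proof.
move=> hf irrP /dvdpP[Q defQ].
by have := hf B Q P irrP; rewrite -defQ [B + _]addrC subrK.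
Qed.

Lemma dvdp_defect_of_agree (F : fieldType) (f : {poly F} -> {poly F})
    (d : {poly F}) (H : {poly {poly F}}) (A B P : {poly F}) :
  prime_congruence f -> d * f B = H.[B] -> irreducible_poly P ->
  P %| A - B -> P %| d * f A - H.[A].
Proof.
move=> hf agreeB irrP P_dvd.
have -> : d * f A - H.[A] = d * (f A - f B) - (H.[A] - H.[B]).
  by rewrite -agreeB; ring.
rewrite dvdp_sub ?dvdp_mull //; first exact: congruence_dvdp.
exact: dvdp_trans (dvdp_horner_sub _ _ _).
Qed.

(** * Comparison with a node *)

(** The cofactor is the derivative of [A - U ^+ N] reduced modulo [A - U ^+ N]
    after multiplication by [U].  In this form it depends on [N] only through
    its image in [F], which lets [N] grow without changing the right-hand
    side. *)
Lemma dvdp_wronskian_defect (F : finFieldType) (f : {poly F} -> {poly F})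
    (d U A : {poly F}) (H : {poly {poly F}}) (N : nat) :
  prime_congruence f -> d * f (U ^+ N) = H.[U ^+ N] ->
  A - U ^+ N %| (U * A^`() - (U^`() * A) *+ N) * (d * f A - H.[A]).
Proof.
move=> hf agreeN; set Z := d * f A - _; set g := A - U ^+ N.
have g_dvd : g %| g^`() * Z.
  by apply: dvdp_deriv_mul => P irrP; apply: dvdp_defect_of_agree.
have -> : (U * A^`() - (U^`() * A) *+ N) * Z =
          U * (g^`() * Z) - g * (U^`() * Z *+ N).
  rewrite /g derivB deriv_exp.
  case: N {agreeN g g_dvd} => [|N]; first by rewrite !mulr0n; ring.
  by rewrite exprS /=; ring.
by apply: dvdp_sub; [apply: dvdp_mull | apply: dvdp_mulr].
Qed.

(** The elements [V * Q ^+ j - 1] are coprime up to the factors [Q ^+ i - 1],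
    because [V * Q ^+ j - 1] and [V * Q ^+ (j + i) - 1] combine to
    [Q ^+ i - 1].  The precise bookkeeping is that of the partial fraction
    expansion of the inverse of their product, whose coefficients have, up
    to powers of [Q], the right-hand product as common denominator. *)
Lemma prod_progression_dvdp (R : idomainType) (V Q T : {poly R}) (k : nat) :
  (forall j, (j <= k)%N -> V * Q ^+ j - 1 %| T) ->
  \prod_(j < k.+1) (V * Q ^+ j - 1) %| T * \prod_(i < k) (Q ^+ i.+1 - 1).
Proof.
elim: k V => [|k IHk] V T_dvd.
  by rewrite big_ord_recr !big_ord0 /= mul1r mulr1 T_dvd.
have left_dvd := IHk V (fun j le_jk => T_dvd j (leqW le_jk)).
have right_dvd : \prod_(j < k.+1) (V * Q ^+ j.+1 - 1) %|
                 T * \prod_(i < k) (Q ^+ i.+1 - 1).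
  under eq_bigr => j _ do rewrite exprS mulrA.
  by apply: IHk => j le_jk; rewrite -mulrA -exprS T_dvd.
rewrite [\prod_(i < k.+1) _]big_ord_recr mulrA /=.
set Y := T * _ in left_dvd right_dvd *.
(* [Q ^+ k.+1 - 1] combines the two extreme factors, and [Y] is a multiple of
   the product with either of them left out. *)
have -> : Y * (Q ^+ k.+1 - 1) =
          Y * (V * Q ^+ k.+1 - 1) - Q ^+ k.+1 * ((V * Q ^+ 0 - 1) * Y).
  by rewrite expr0; ring.
apply: dvdp_sub.
  by rewrite big_ord_recr /= dvdp_mul.
by rewrite big_ord_recl /= dvdp_mull // dvdp_mul.
Qed.

(** * Interpolation and degree estimates *)

(** Lagrange interpolation over the fraction field, with denominators cleared
    so that the divisibility arguments stay inside the ring. *)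
Lemma common_denominator_interpolation (D : idomainType) (x y : nat -> D) n :
  (forall i j, x i = x j -> i = j) ->
  exists d : D, exists H : {poly D}, [/\ d != 0, (size H <= n)%N
    & forall i, (i < n)%N -> d * y i = H.[x i]].
Proof.
move=> x_inj; elim: n => [|n [d [H [d_neq0 size_H agree]]]].
  by exists 1, 0; rewrite oner_eq0 size_poly0.
(* Newton's step: scaling by [W.[x n]] makes the correction integral. *)
pose W := \prod_(j < n) ('X - (x j)%:P).
have W_at i : W.[x i] = \prod_(j < n) (x i - x j).
  by rewrite horner_prod; apply: eq_bigr => j _; rewrite hornerXsubC.
exists (d * W.[x n]), (W.[x n] *: H + (d * y n - H.[x n]) *: W); split.
- rewrite mulf_neq0 // W_at; apply/prodf_neq0 => j _.
  by rewrite subr_eq0; apply/eqP => /x_inj; have := ltn_ord j; lia.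
- apply: leq_trans (size_polyD _ _) _; rewrite geq_max.
  rewrite (leq_trans (size_scale_leq _ _)) ?(leqW size_H) //.
  by rewrite (leq_trans (size_scale_leq _ _)) // size_prod_XsubC /index_enum -enumT size_enum_ord.
- move=> i; rewrite ltnS leq_eqVlt hornerD !hornerZ => /predU1P[->|lt_in].
    by ring.
  have -> : W.[x i] = 0.
    by rewrite W_at (bigD1 (Ordinal lt_in)) //= subrr mul0r.
  by rewrite -agree //; ring.
Qed.

Lemma size_gt1_deriv_neq0 (R : nzRingType) (U : {poly R}) :
  U^`() != 0 -> (1 < size U)%N.
Proof.
rewrite ltnNge; apply: contra => /size1_polyC ->.
by rewrite derivC.
Qed.

Lemma size_exp_poly (R : idomainType) (U : {poly R}) N :
  U != 0 -> size (U ^+ N) = ((size U).-1 * N).+1.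
Proof.
move=> U_neq0; rewrite -size_exp prednK //.
by rewrite size_poly_gt0 expf_neq0.
Qed.

Lemma size_prod_ge (R : idomainType) (G : nat -> {poly R}) s n :
  (forall j, (j < n)%N -> (s < size (G j))%N) ->
  (n * s < size (\prod_(j < n) G j)%R)%N.
Proof.
elim: n => [|n IHn] G_gt; first by rewrite big_ord0 size_poly1.
have IH : (n * s < size (\prod_(j < n) G j)%R)%N.
  by apply: IHn => j lt_jn; apply: G_gt; lia.
have Gn := G_gt n (leqnn _).
rewrite big_ord_recr /= size_mul -?size_poly_gt0; first 1 last.
- exact: leq_ltn_trans IH.
- exact: leq_ltn_trans Gn.
by move: IH Gn; move: (size _) (size _) => s1 s2; rewrite mulSn; lia.
Qed.

Lemma size_horner_exp (R : idomainType) (U : {poly R}) (H : {poly {poly R}}) k :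
  (size H <= k.+1)%N ->
  exists h, forall N, (size (H.[U ^+ N])%R <= h + k * (size U).-1 * N)%N.
Proof.
move=> size_H; exists (\max_(i < k.+1) size (H`_i)%R) => N.
rewrite (horner_coef_wide _ size_H).
apply: leq_trans (size_sum _ _ _) _; apply/bigmax_leqP => i _.
apply: leq_trans (size_polyMleq _ _) _.
have := size_poly_exp_leq U (N * i); rewrite -exprM.
have := leq_bigmax (F := fun i : 'I_k.+1 => size H`_i) i.
have : (i <= k)%N by rewrite -ltnS.
move: (\max_(i < _) _) (size (U ^+ _)%R) (size (H`_i)%R) => M s1 s2.
move=> le_ik /= le_s2 le_s1.
have : ((size U).-1 * (N * i) <= k * (size U).-1 * N)%N.
  by rewrite mulnA [(_ * i)%N]mulnC -(mulnA k) leq_mul2r le_ik orbT.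
by move: le_s1; move: (_ * (N * i))%N (_ * N)%N => e1 e2; lia.
Qed.

(** * Agreement at large powers, then everywhere *)

(** The degree of the defect at [U ^+ N] grows at most like [k * deg U * N],
    while the [k + 1] nodes force divisors of total degree
    [(k + 1) * deg U * N] up to a constant.  Hence the number of nodes exceeds
    the growth rate [k] by one.  The common difference [p] of the node exponents
    ensures that [N - (c + p * i)] is invertible in [F] for all nodes at once. *)
Lemma agree_on_large_powers (F : finFieldType) (f : {poly F} -> {poly F})
    (U d : {poly F}) (H : {poly {poly F}}) (p c k b : nat) :
  prime_congruence f -> U^`() != 0 -> (0 < p)%N -> p%:R = 0 :> F ->
  (size H <= k.+1)%N -> (forall n, (size (f (U ^+ n)) <= k * n + b)%N) ->
  (forall i, (i <= k)%N ->
     d * f (U ^+ (c + p * i)) = H.[U ^+ (c + p * i)]) ->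
  exists N0, forall N, (N0 <= N)%N -> N%:R != c%:R :> F ->
    d * f (U ^+ N) = H.[U ^+ N].
Proof.
move=> hf dU_neq0 p_gt0 p0 size_H size_f agree.
have U_gt1 := size_gt1_deriv_neq0 dU_neq0.
have U_neq0 : U != 0 by apply: contra_neq dU_neq0 => ->; rewrite deriv0.
have [h size_HU] := size_horner_exp U size_H.
have size_sub1 m : (0 < m)%N -> size (U ^+ m - 1) = ((size U).-1 * m).+1.
  move=> m_gt0; rewrite size_polyDl size_exp_poly // size_polyN size_poly1.
  by rewrite ltnS muln_gt0 m_gt0 andbT -subn1 subn_gt0.
pose E := \prod_(i < k) ((U ^+ p) ^+ i.+1 - 1).
have E_neq0 : E != 0.
  apply/prodf_neq0 => i _; rewrite -exprM -size_poly_gt0 size_sub1 //; lia.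
pose const := (size U^`() + size d + b + h + size E)%N.
(* [const] bounds what does not depend on [N] in the degrees of [U' * Z * E];
   the last summand pays for the gap between [N - (c + p * k)] and [N]. *)
exists (1 + c + p * k + const + k.+1 * (size U).-1 * (c + p * k))%N.
move=> N le_N0 Nc; apply/eqP; rewrite -subr_eq0; apply/negPn/negP => Z_neq0.
set Z := _ - _ in Z_neq0.
have U'Z_dvd i : (i <= k)%N -> U ^+ (N - (c + p * i)) - 1 %| U^`() * Z.
  move=> le_ik; set n := (c + p * i)%N; set m := (N - n)%N.
  have defN : N = (n + m)%N by rewrite /m /n; nia.
  have := dvdp_wronskian_defect (U ^+ N) hf (agree i le_ik).
  rewrite -/n -/Z.
  have -> : (U * (U ^+ N)^`() - U^`() * U ^+ N *+ n) * Z =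
            U ^+ n * (m%:R%:P * (U ^+ m * (U^`() * Z))).
    rewrite deriv_exp.
    have -> : U * (U^`() * U ^+ N.-1 *+ N) = U^`() * U ^+ N *+ N.
      case: (N) => [|l]; first by rewrite !mulr0n mulr0.
      by rewrite /= exprS; ring.
    by rewrite polyC_natr defN exprD; ring.
  have -> : U ^+ N - U ^+ n = U ^+ n * (U ^+ m - 1).
    by rewrite defN exprD; ring.
  have m_neq0 : m%:R != 0 :> F.
    apply: contra Nc => /eqP m0; rewrite defN !natrD m0 natrM p0.
    by rewrite mul0r !addr0.
  rewrite dvdp_mul2l ?expf_neq0 // mul_polyC dvdpZr // => dvdUm.
  have -> : U^`() * Z = U ^+ m * (U^`() * Z) - (U ^+ m - 1) * (U^`() * Z).
    by ring.
  by apply: dvdp_sub => //; apply: dvdp_mulr.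
(* The nodes are read backwards: the smallest exponent [a] comes from the last
   node. *)
pose a := (N - (c + p * k))%N.
have: \prod_(j < k.+1) (U ^+ a * (U ^+ p) ^+ j - 1) %| (U^`() * Z) * E.
  apply: prod_progression_dvdp => j le_jk.
  rewrite -exprM -exprD.
  have -> : (a + p * j = N - (c + p * (k - j)))%N by rewrite /a; nia.
  by apply: U'Z_dvd; rewrite leq_subr.
have T_neq0 : U^`() * Z != 0 by rewrite mulf_neq0.
move/(dvdp_leq (mulf_neq0 T_neq0 E_neq0)).
have prod_gt : (k.+1 * ((size U).-1 * a) <
    size (\prod_(j < k.+1) (U ^+ a * (U ^+ p) ^+ j - 1))%R)%N.
  pose G j := U ^+ a * (U ^+ p) ^+ j - 1.
  apply: (@size_prod_ge _ G) => j _; rewrite /G -exprM -exprD size_sub1 /a; nia.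
move/(leq_trans prod_gt); rewrite size_mul // size_mul //.
have size_Z : (size Z <= size d + b + h + k * (size U).-1 * N)%N.
  have le_kN : (k * N <= k * (size U).-1 * N)%N.
    by rewrite leq_mul2r leq_pmulr ?orbT // -subn1 subn_gt0.
  apply: leq_trans (size_polyD _ _) _; rewrite size_polyN geq_max.
  move: (size_HU N) (size_f N) (size_polyMleq d (f (U ^+ N))) le_kN.
  move: (size (d * _)%R) (size (f _)) (size d) => s1 s2 s3.
  move: (_ * N)%N (_ * N)%N (size H.[_])  => e1 e2 s4.
  lia.
move: size_Z le_N0; rewrite /a /const.
move: (size Z) (size E) (size U^`()) (size d) => sZ sE sU' sd.
move: U_gt1; case: (size U) => // [[|u]] //= _.
rewrite -(addnA 1%N).
move: (c + p * k)%N => q le_Z le_N.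
have -> : (k.+1 * (u.+1 * (N - q)) =
           u.+1 * N + k * u.+1 * N - k.+1 * u.+1 * q)%N.
  by rewrite mulnA mulnBr mulSn mulnDl.
have : (N <= u.+1 * N)%N by rewrite leq_pmull.
move: (u.+1 * N)%N (k * u.+1 * N)%N (k.+1 * u.+1 * q)%N le_Z le_N.
move=> e1 e2 e3; lia.
Qed.

(** Euclid's argument: an irreducible factor of [Z * 'X + 1] is prime to
    [Z]. *)
Lemma eq0_irreducible_dvdp (F : finFieldType) (Z : {poly F}) :
  (forall P, irreducible_poly P -> P %| Z) -> Z = 0.
Proof.
move=> Z_dvd; apply/eqP/negPn/negP => Z_neq0.
have ZX_gt1 : (1 < size (Z * 'X + 1)%R)%N.
  by rewrite size_MXaddC (negPf Z_neq0) /= ltnS size_poly_gt0.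
have [P irrP P_dvd] := irreducible_factor ZX_gt1.
have : P %| 1.
  by rewrite -(dvdp_addr _ (dvdp_mulr 'X (Z_dvd P irrP))).
by rewrite dvdp1; case: irrP => /[swap] _ /[swap] /eqP ->.
Qed.

(** Both residues [0] and [1] are needed: for each single residue [e] there are
    nonzero [A] with [U * A' = e * U' * A], namely constants for [e = 0] and [U]
    itself for [e = 1]. *)
Lemma agree_everywhere (F : finFieldType) (f : {poly F} -> {poly F})
    (U d : {poly F}) (H : {poly {poly F}}) (p N0 : nat) :
  prime_congruence f -> U^`() != 0 -> (0 < p)%N -> p%:R = 0 :> F ->
  (forall N, (N0 <= N)%N -> N%:R = 0 :> F \/ N%:R = 1 :> F ->
     d * f (U ^+ N) = H.[U ^+ N]) ->
  forall A, d * f A = H.[A].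
Proof.
move=> hf dU_neq0 p_gt0 p0 agree.
have U_gt1 := size_gt1_deriv_neq0 dU_neq0.
have U_neq0 : U != 0 by apply: contra_neq dU_neq0 => ->; rewrite deriv0.
have agree_ne0 A : A != 0 -> d * f A = H.[A].
  move=> A_neq0; apply/eqP; rewrite -subr_eq0; apply/negPn/negP => Z_neq0.
  set Z := _ - _ in Z_neq0.
  have vanish (e : bool) : U * A^`() - U^`() * A *+ e = 0.
    set W := U * _ - _.
    apply/eqP/negPn/negP => W_neq0.
    pose N := (p * (N0 + size A + size (W * Z)%R) + e)%N.
    have N_e : N%:R = e%:R :> F by rewrite natrD natrM p0 mul0r add0r.
    have : A - U ^+ N %| W * Z.
      have -> : W = U * A^`() - U^`() * A *+ N.
        by rewrite /W -[_ *+ N]mulr_natr -polyC_natr N_e polyC_natr mulr_natr.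
      apply: dvdp_wronskian_defect => //; apply: agree; first by rewrite /N; nia.
      by rewrite N_e; case: (e); [right|left].
    move/(dvdp_leq (mulf_neq0 W_neq0 Z_neq0)); apply/negP; rewrite -ltnNge.
    have le_N : (size A + size (W * Z)%R <= (size U).-1 * N)%N.
      apply: (@leq_trans N); first by rewrite /N; nia.
      by rewrite leq_pmull // -subn1 subn_gt0.
    rewrite addrC size_polyDl size_polyN size_exp_poly // ltnS.
      exact: leq_trans (leq_addl _ _) le_N.
    exact: leq_trans (leq_addr _ _) le_N.
  have := vanish true; have := vanish false.
  rewrite mulr0n subr0 mulr1n => -> /eqP.
  by rewrite sub0r oppr_eq0 mulf_eq0 (negPf dU_neq0) (negPf A_neq0).
move=> A; have [->|/agree_ne0 //] := eqVneq A 0.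
apply/eqP; rewrite -subr_eq0; apply/eqP/eq0_irreducible_dvdp => P irrP.
apply: (@dvdp_defect_of_agree _ f d H 0 P) => //.
  exact/agree_ne0/irredp_neq0.
by rewrite sub0r dvdpNr.
Qed.

Theorem theorem3p1 (F : finFieldType) (f : {poly F} -> {poly F})
  (hf : prime_congruence f)
  (hU : exists (U : {poly F}) (C5 C6 : nat),
      [/\ U^`() != 0, (0 < C5)%N, (0 < C6)%N
        & forall n : nat, deg_le (f (U ^+ n)) (C5 * n + C6)%N]) :
  polynomial_map f.
Proof.
have [U [k [b [dU_neq0 _ _ deg_f]]]] := hU.
have size_f n : (size (f (U ^+ n)) <= k * n + b.+1)%N.
  by rewrite addnS; apply: deg_f.
have [p p_pr /andP[_ /eqP p0]] := finPcharP F.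
have p_gt0 := prime_gt0 p_pr.
have U_gt1 := size_gt1_deriv_neq0 dU_neq0.
have U_neq0 : U != 0 by apply: contra_neq dU_neq0 => ->; rewrite deriv0.
have nodes_inj i j : U ^+ (0 + p * i) = U ^+ (0 + p * j) -> i = j.
  move/(congr1 (fun A : {poly F} => size A)); rewrite !size_exp_poly //.
  move=> [/eqP]; rewrite !eqn_pmul2l //; first by move/eqP.
  by rewrite -subn1 subn_gt0.
have [d [H [d_neq0 size_H agree0]]] :=
  common_denominator_interpolation (fun i => f (U ^+ (0 + p * i))) k.+1 nodes_inj.
have [N1 agree1] :=
  agree_on_large_powers hf dU_neq0 p_gt0 p0 size_H size_f agree0.
have one_mod i : (1 + p * i)%:R = 1 :> F by rewrite natrD natrM p0 mul0r addr0.
(* The new nodes lie in the residue class 1 and beyond [N1], where agreement is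
   already known; they reach the multiples of [p]. *)
have [|N2 agree2] := @agree_on_large_powers _ f U d H p (1 + p * N1) k b.+1
                       hf dU_neq0 p_gt0 p0 size_H size_f.
  move=> i _; rewrite -addnA -mulnDr; apply: agree1; first nia.
  by rewrite one_mod oner_eq0.
have agree : forall A, d * f A = H.[A].
  apply: (@agree_everywhere _ f U d H p (N1 + N2)) => // N le_N [N_0|N_1].
    by apply: agree2; rewrite ?one_mod ?N_0 1?eq_sym ?oner_eq0 //; lia.
  by apply: agree1; rewrite ?N_1 ?oner_eq0 //; lia.
exists ((tofrac d)^-1 *: map_poly (@tofrac {poly F}) H) => A.
rewrite hornerZ horner_map /= -agree rmorphM mulKf //.
by rewrite tofrac_eq0.
Qed.
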